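(* Let $\{x_n\}\subset U$ be a sequence generated by the method of codifferential descent (MCD) applied to $f\colon U\to\mathbb{R}$ with parameters $\{\nu_n\},\{\mu_n\}\subset[0,+\infty]$, and let $x^*\in U$ be a cluster point of $\{x_n\}$. Suppose that the codifferential mapping $Df$ is continuous at $x^*$ and uniformly approximates $f$ in a neighbourhood of $x^*$. Let also $f$ be bounded below on $U$, $\liminf_{n\to\infty}\nu_n>0$ and $\liminf_{n\to\infty}\mu_n>0$. Suppose finally that one of the following two assumptions holds true: (1) $\mathcal{H}$ is finite dimensional; (2) there exists $\widehat{\mu}>0$ such that $\{(b,w)\in\overline{d}f(x_n)\mid b\le\widehat{\mu}\}\subseteq\overline{d}_{\mu_n}f(x_n)$ for all sufficiently large $n\in\mathbb{N}$. Then $x^*$ is an inf-stationary point of $f$. If, in addition, $f$ is convex, then $x^*$ is a point of global minimum of $f$.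
   Context: Codifferentials. $\mathcal{H}$ is a real Hilbert space with inner product $\langle\cdot,\cdot\rangle$, $B(y,r)=\{z\in\mathcal{H}\mid\|z-y\|\le r\}$, and $\mathbb{R}\times\mathcal{H}$ carries the inner product $\langle(a,v),(b,w)\rangle=ab+\langle v,w\rangle$ and the corresponding norm. A function $f$ defined in a neighbourhood of $x$ is codifferentiable at $x$ if there exist (nonempty) weakly compact convex sets $\underline{d}f(x),\overline{d}f(x)\subset\mathbb{R}\times\mathcal{H}$ such that for any $\Delta x\in\mathcal{H}$ $$\lim_{\alpha\to+0}\frac1\alpha\Big|f(x+\alpha\Delta x)-f(x)-\max_{(a,v)\in\underline{d}f(x)}(a+\alpha\langle v,\Delta x\rangle)-\min_{(b,w)\in\overline{d}f(x)}(b+\alpha\langle w,\Delta x\rangle)\Big|=0$$ and $\max_{(a,v)\in\underline{d}f(x)}a+\min_{(b,w)\in\overline{d}f(x)}b=0$. The pair $Df(x)=[\underline{d}f(x),\overline{d}f(x)]$ is called a codifferential of $f$ at $x$. Throughout, codifferentials are normalized: $\max_{(a,v)\in\underline{d}f(x)}a=\min_{(b,w)\in\overline{d}f(x)}b=0$. Setting. $U\subseteq\mathcal{H}$ is open, $f\colon U\to\mathbb{R}$ is codifferentiable on $U$, and a codifferential mapping $x\mapsto Df(x)$, $x\in U$, is fixed. $Df$ is continuous at a point if both multifunctions $\underline{d}f(\cdot)$, $\overline{d}f(\cdot)$ are Hausdorff continuous at this point. For $B(x,r)\subset U$, $\Delta x\in B(0,r)$, $\alpha\in(0,1]$ put $$\varepsilon_f(\alpha,\Delta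 x,x,r)=\frac1\alpha\Big(f(x+\alpha\Delta x)-f(x)-\max_{(a,v)\in\underline{d}f(x)}(a+\alpha\langle v,\Delta x\rangle)-\min_{(b,w)\in\overline{d}f(x)}(b+\alpha\langle w,\Delta x\rangle)\Big).$$ $Df$ uniformly approximates $f$ on a set $C\subset U$ if there exists $r>0$ such that $B(x,r)\subseteq U$ for all $x\in C$ and $\varepsilon_f(\alpha,\Delta x,x,r)\to0$ as $\alpha\to+0$ uniformly for all $\Delta x\in B(0,r)$ and $x\in C$. A point $x^*\in U$ is an inf-stationary point of $f$ if $0\in\underline{d}f(x^* )+(0,w)$ for all $(0,w)\in\operatorname{ext}\overline{d}f(x^* )$, where $\operatorname{ext}$ denotes the set of extreme points. Truncated codifferential. For all $\nu,\mu\in[0,+\infty]$, set-valued mappings $\underline{d}_\nu f,\overline{d}_\mu f\colon U\rightrightarrows\mathbb{R}\times\mathcal{H}$ are given such that for all $x\in U$: $\{(a,v)\in\operatorname{ext}\underline{d}f(x)\mid a\ge-\nu\}\subseteq\underline{d}_\nu f(x)\subseteq\underline{d}f(x)$ and $\{(b,w)\in\operatorname{ext}\overline{d}f(x)\mid b\le\mu\}\subseteq\overline{d}_\mu f(x)\subseteq\overline{d}f(x)$. MCD. Choose sequences $\{\nu_n\},\{\mu_n\}\subset[0,+\infty]$, $\alpha_*\in(0,+\infty]$ and $x_0\in U$ (if $\alpha_*=+\infty$, then $[0,\alpha_*]$ means $[0,+\infty)$). At iteration $n\ge0$: for every $z\in\overline{d}_{\mu_n}f(x_n)$ let $(a_n(z),v_n(z))$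 be the element of least norm of $\operatorname{cl}\operatorname{co}\underline{d}_{\nu_n}f(x_n)+z$; choose $\alpha_n(z)\in\arg\min\{f(x_n-\alpha v_n(z))\mid\alpha\in[0,\alpha_*],\ x_n-\alpha v_n(z)\in U\}$; choose $z_n\in\arg\min\{f(x_n-\alpha_n(z)v_n(z))\mid z\in\overline{d}_{\mu_n}f(x_n)\}$; and set $x_{n+1}=x_n-\alpha_n(z_n)v_n(z_n)$. It is assumed that $\alpha_n(z)$ and $z_n$ are well defined (the minima are attained) at every iteration. ''$f$ is convex'' means that $U$ is convex and $f$ is convex on $U$. *)

(* Defs.v *)
(* MathComp / MathComp-Analysis *)
From HB Require Import structures.
From mathcomp Require Import all_boot all_order all_algebra.
From mathcomp Require Import sesquilinear.
From mathcomp Require Import all_classical all_reals all_analysis.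

Set Implicit Arguments.
Unset Strict Implicit.
Unset Printing Implicit Defensive.

Import Order.TTheory GRing.Theory Num.Theory.
Import numFieldNormedType.Exports.

Local Open Scope classical_set_scope.
Local Open Scope ring_scope.

Section Sets.

(* For a set without a greatest (resp. least) element the value is 0. This does
   not happen below: the images in question are those of nonempty weakly compact
   sets under continuous affine functions. *)
Definition set_max {R : realType} (A : set R) : R :=
  xget 0 [set m | A m /\ ubound A m].

Definition set_min {R : realType} (A : set R) : R :=
  xget 0 [set m | A m /\ lbound A m].

Definition argmin {T : Type} {R : realType} (A : set T) (g : T -> R) : set T :=
  [set s | A s /\ forall t, A t -> g s <= g t].

Definition extreme_points {R : realType} {E : lmodType R} (A : set E) : set E :=
  [set p | A p /\ forall (q r : E) (t : R), A q -> A r -> 0 < t < 1 ->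
     p = t *: q + (1 - t) *: r -> q = p /\ r = p].

Definition convex_hull {R : realType} {E : lmodType R} (A : set E) : set E :=
  smallest (@convex_set R E) A.

Definition eval_dual {R : realType} (E : normedModType R) :
    E -> {ptws {l : {linear E -> R^o} | continuous l} -> R^o} :=
  fun x l => sval l x.

(* E with the coarsest topology making every norm-continuous linear functional
   continuous. *)
Definition weak_space {R : realType} (E : normedModType R) : Type := E.

HB.instance Definition _ (R : realType) (E : normedModType R) :=
  Topological.copy (weak_space E) (initial_topology (@eval_dual R E)).

Definition weakly_compact {R : realType} {E : normedModType R} (A : set E) :=
  compact (A : set (weak_space E)).

Definition finite_dimensional {R : realType} (E : lmodType R) : Prop :=
  exists (n : nat) (e : 'I_n -> E),
    forall x : E, exists c : 'I_n -> R, x = \sum_i c i *: e i.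

End Sets.

Section Codifferential.

Variables (R : realType) (H : completeNormedModType R).

Local Notation RH := (R^o * H)%type.

Variable ip : {dot H for (@idfun R)}.

(* The library norm on a product is the max norm; the Euclidean one is needed
   for elements of least norm. Both induce the same topology, so closures and
   weak compactness below refer to the library structure on the product. *)
Definition pdot (p q : RH) : R := p.1 * q.1 + ip p.2 q.2.

Definition pnorm (p : RH) : R := Num.sqrt (pdot p p).

Definition hausdorff_dist (A B : set RH) : \bar R :=
  let excess A B :=
    ereal_sup [set ereal_inf [set (pnorm (p - q))%:E | q in B] | p in A] in
  maxe (excess A B) (excess B A).

Definition hausdorff_continuous_at (F : H -> set RH) (x : H) : Prop :=
  hausdorff_dist (F y) (F x) @[y --> x] --> 0%E.

Definition codiff_error (f : H -> R) (A B : set RH) (x : H) (alpha : R)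
    (Dx : H) : R :=
  alpha^-1 * (f (x + alpha *: Dx) - f x
     - set_max [set p.1 + alpha * ip p.2 Dx | p in A]
     - set_min [set p.1 + alpha * ip p.2 Dx | p in B]).

Definition is_codifferential (f : H -> R) (x : H) (A B : set RH) : Prop :=
  [/\ [/\ A !=set0, convex_set A & weakly_compact A],
      [/\ B !=set0, convex_set B & weakly_compact B],
      forall Dx : H,
        `|codiff_error f A B x alpha Dx| @[alpha --> 0^'+] --> (0 : R) &
      set_max [set p.1 | p in A] + set_min [set p.1 | p in B] = 0].

Definition normalized (A B : set RH) : Prop :=
  set_max [set p.1 | p in A] = 0 /\ set_min [set p.1 | p in B] = 0.

Definition uniformly_approximates (U : set H) (f : H -> R)
    (dl du : H -> set RH) (C : set H) : Prop :=
  exists r : R, [/\ 0 < r,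
    forall x, C x -> closed_ball_ Num.norm x r `<=` U &
    forall e : R, 0 < e -> \forall alpha \near 0^'+,
      forall x Dx, C x -> closed_ball_ Num.norm 0 r Dx ->
        `|codiff_error f (dl x) (du x) x alpha Dx| < e].

Definition inf_stationary (A B : set RH) : Prop :=
  forall w : H, extreme_points B (0, w) -> [set p + (0, w) | p in A] 0.

Definition truncation (U : set H) (dl du : H -> set RH)
    (dlT duT : \bar R -> H -> set RH) : Prop :=
  forall (t : \bar R) (x : H), (0 <= t)%E -> U x ->
    [/\ [set p | extreme_points (dl x) p /\ (- t <= p.1%:E)%E] `<=` dlT t x,
        dlT t x `<=` dl x,
        [set p | extreme_points (du x) p /\ (p.1%:E <= t)%E] `<=` duT t x &
        duT t x `<=` du x].

(* p n z is the pair (a_n(z), v_n(z)). The constraint a%:E <= astar reads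
   a < +oo, hence is void, when astar = +oo. *)
Definition MCD_sequence (U : set H) (f : H -> R)
    (dlT duT : \bar R -> H -> set RH) (nu mu : nat -> \bar R) (astar : \bar R)
    (x : nat -> H) : Prop :=
  U (x 0%N) /\
  exists (p : nat -> RH -> RH) (alpha : nat -> RH -> R) (zs : nat -> RH),
  forall n : nat,
    [/\ forall z, duT (mu n) (x n) z ->
          argmin [set q + z | q in closure (convex_hull (dlT (nu n) (x n)))]
            pnorm (p n z),
        forall z, duT (mu n) (x n) z ->
          argmin [set a | [/\ 0 <= a, (a%:E <= astar)%E &
                              U (x n - a *: (p n z).2)]]
            (fun a => f (x n - a *: (p n z).2)) (alpha n z),
        argmin (duT (mu n) (x n))
          (fun z => f (x n - alpha n z *: (p n z).2)) (zs n) &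
        x n.+1 = x n - alpha n (zs n) *: (p n (zs n)).2].

End Codifferential.

(* Main.v *)
Require Import Defs.
From HB Require Import structures.
From mathcomp Require Import all_boot all_order all_algebra.
From mathcomp Require Import sesquilinear.
From mathcomp Require Import all_classical all_reals all_analysis.
From mathcomp Require Import ring lra.

Set Implicit Arguments.
Unset Strict Implicit.
Unset Printing Implicit Defensive.

Import Order.TTheory GRing.Theory Num.Theory.
Import numFieldNormedType.Exports.

Local Open Scope classical_set_scope.
Local Open Scope ring_scope.

(** Write <p, q> for the inner product of R x H. If (0, w) lies in du xs while
    (0, -w) does not lie in dl xs, the element u of least norm of the convex set
    dl xs + (0, w) separates it from 0: <u, q + (0, w)> >= c > 0 for all q in
    dl xs (pdot_separation). This inequality survives a small change of xs in
    the following form (extreme_point_near). For y near xs, let z be an extreme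
    point of du y at which u - M (1, 0) is maximal. By Hausdorff continuity z is
    almost as far as (0, w) in the direction u, so <u, q + z> >= c / 2 on dl y,
    and a large M makes the first component of z as small as desired. Hence z
    belongs to the truncated hyperdifferential used by the method, and every
    least norm element p = (a, v) that the method attaches to z has norm bounded
    below; the norm is also bounded above, since weakly compact sets are bounded
    by the uniform boundedness principle (weakly_compact_bounded).

    The codifferential model then decreases by a fixed amount along a step b v
    whose length b does not depend on y (model_decrease): the maximum over dl y
    is attained at an extreme point q, and either q was kept by the truncation
    and the variational inequality <p, q + z> >= <p, p> applies, or its first
    component is at most a fixed negative number, which dominates for small b.
    Uniform approximation transfers this decrease to f (descent_near). As the
    line search is exact, f drops by a fixed amount whenever the sequence visits
    a neighbourhood of xs. There are infinitely many visits, f decreases along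
    the sequence and f is bounded below, a contradiction (MCD_stationary).

    That extreme points maximize continuous functionals over weakly compact sets
    is the Krein-Milman argument of the first part, based on Zorn's lemma.

    For convex f, a value f y < f xs gives a rate of decrease of f from xs
    towards y that is bounded away from 0. The expansion of f at xs turns it
    into nonempty weakly closed subsets of du xs that shrink with the step; a
    common point of these contradicts stationarity at the point of du xs with
    first component 0 and least slope in the direction y - xs
    (convex_stationary_min). *)

(** * Extreme points of weakly compact sets *)

(** Cantor's intersection principle, phrased with the open complements: the
    traces of the complements form a filter base, and a cluster point of that
    filter in [A] cannot lie in any member of the chain. *)
Lemma compact_open_chain (T : topologicalType) (A : set T) (F : set (set T)) :
  compact A -> A !=set0 -> total_on F subset ->
  (forall W, F W -> open W /\ A `\` W !=set0) ->
  A `\` \bigcup_(W in F) W !=set0.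
Proof.
move=> cA [a Aa] totF FW.
have [[W0 FW0]|F0] := pselect (F !=set0); last first.
  by exists a; split => // -[W FWW]; case: F0; exists W.
have FG : Filter (filter_from F (fun W => A `\` W)).
  apply: filter_from_filter; first by exists W0.
  move=> W1 W2 F1 F2; have [s|s] := totF _ _ F1 F2.
    by exists W2 => // x [Ax nx]; split; split => // /s.
  by exists W1 => // x [Ax nx]; split; split => // /s.
have PG : ProperFilter (filter_from F (fun W => A `\` W)).
  by apply: filter_from_proper => W /FW[].
have GA : filter_from F (fun W => A `\` W) A by exists W0 => // x [].
have [p [Ap clp]] := cA _ PG GA.
exists p; split => // -[W FWW Wp].
have [||x [[_ nWx] Wx]] := clp (A `\` W) W.
- by exists W.
- by apply: open_nbhs_nbhs; split => //; have [] := FW _ FWW.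
- exact: nWx.
Qed.

Lemma weak_continuous (R : realType) (E : normedModType R)
    (l : {linear E -> R^o}) :
  continuous l -> continuous (l : weak_space E -> R^o).
Proof.
move=> lc x.
pose l' : {l : {linear E -> R^o} | continuous l} := exist _ l lc.
pose S := {ptws {l : {linear E -> R^o} | continuous l} -> R^o}.
apply: (@continuous_comp (weak_space E) S R^o (@eval_dual R E)
  (fun g => g l')).
  exact: initial_continuous.
have /cvg_sup/(_ l') cvgl : nbhs (@eval_dual R E x : S) --> (@eval_dual R E x : S).
  exact: cvg_id.
apply: cvg_trans; last exact: (@initial_continuous S R^o (fun g => g l')).
exact: (cvg_app _ cvgl).
Qed.

Lemma weakly_compact_argmax (R : realType) (E : normedModType R) (A : set E)
    (l : {linear E -> R^o}) :
  A !=set0 -> weakly_compact A -> continuous l ->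
  exists2 p, A p & forall q, A q -> l q <= l p.
Proof.
move=> A0 cA lc.
have cl : {within (A : set (weak_space E)), continuous l}.
  by apply: continuous_subspaceT; exact: weak_continuous.
have [p Ap pmax] := @compact_EVT_max (weak_space E) R l A A0 cA cl.
by exists p => [|q Aq]; [exact: set_mem|apply: pmax; exact: mem_set].
Qed.

Lemma weakly_closed_ge (R : realType) (E : normedModType R)
    (l : {linear E -> R^o}) (c : R) :
  continuous l -> closed ([set p | c <= l p] : set (weak_space E)).
Proof.
move=> lc; apply: (@preimage_closed (weak_space E) R^o l [set y | c <= y]).
  by move=> x _; exact: weak_continuous.
exact: closed_ge.
Qed.

(** A minimal nonempty relatively closed face is a singleton, because a
    functional that is not constant on it would cut out a smaller face. Minimal
    faces exist by Zorn's lemma, applied to the weakly open complements. *)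
Lemma weakly_compact_extreme_point (R : realType) (E : normedModType R)
    (A : set E) :
  (forall p q : E, (forall l : {linear E -> R^o}, continuous l -> l p = l q) ->
    p = q) ->
  A !=set0 -> weakly_compact A -> exists p, extreme_points A p.
Proof.
move=> sep A0 cA.
pose face (F : set E) := forall (q r : E) (t : R), A q -> A r -> 0 < t < 1 ->
  F (t *: q + (1 - t) *: r) -> F q /\ F r.
pose P (W : set (weak_space E)) :=
  [/\ open W, A `\` W !=set0 & face (A `\` W)].
have [] := @Zorn_bigcup _ P.
  move=> F FP totF; split.
  - by apply: bigcup_open => W /FP[].
  - by apply: (compact_open_chain cA A0 totF) => W /FP[].
  - move=> q r t Aq Ar t01 [Am nm]; split; split => // -[W FW WW].
      have [_ _ fW] := FP _ FW.
      by have [|[_ /(_ WW)]] := fW q r t Aq Ar t01; first by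
        split => // WM; apply: nm; exists W.
    have [_ _ fW] := FP _ FW.
    by have [|_ [_ /(_ WW)]] := fW q r t Aq Ar t01; first by
      split => // WM; apply: nm; exists W.
move=> W [[oW AW0 fW] Wmax].
have lconst l : continuous (l : {linear E -> R^o}) ->
    forall p q, (A `\` W) p -> (A `\` W) q -> l p <= l q.
  move=> lc.
  have cAW : weakly_compact (A `\` W).
    by apply: compact_closedI => //; exact: open_closedC.
  have [p0 [Ap0 Wp0] pmax] := weakly_compact_argmax AW0 cAW lc.
  pose W' : set (weak_space E) := W `|` ~` [set p | l p0 <= l p].
  have PW' : P W'.
    split.
    - apply: openU => //; apply: closed_openC; exact: weakly_closed_ge.
    - by exists p0; split => // -[|]//=; apply; exact: lexx.
    - move=> q r t Aq Ar t01 [Am nm].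
      have [|[_ nq] [_ nr]] := fW q r t Aq Ar t01.
        by split => // WM; apply: nm; left.
      have lq : l q <= l p0 by exact: pmax.
      have lr : l r <= l p0 by exact: pmax.
      have lm : l p0 <= t * l q + (1 - t) * l r.
        apply: contrapT => h; apply: nm; right => /=.
        by rewrite linearD !linearZ.
      by split; split => // -[//|]; apply => /=; nra.
  move=> p q [Ap np] [Aq nq].
  apply: le_trans (pmax _ (conj Ap np)) _; apply: contrapT => h.
  apply: (Wmax W') => //; split; first by move=> x; left.
  by move=> /(_ q (or_intror h)).
have [p [Ap nWp]] := AW0.
have single q : (A `\` W) q -> q = p.
  move=> AWq; apply: sep => l lc; apply/eqP; rewrite eq_le.
  by rewrite !lconst.
exists p; split => // q r t Aq Ar t01 pE.
have [|/single -> /single ->//] := fW q r t Aq Ar t01.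
by rewrite -pE.
Qed.

(** The maximizers of a functional form a weakly compact face, and an extreme
    point of a face is an extreme point of the whole set. *)
Lemma weakly_compact_extreme_argmax (R : realType) (E : normedModType R)
    (A : set E) (l : {linear E -> R^o}) :
  (forall p q : E, (forall l : {linear E -> R^o}, continuous l -> l p = l q) ->
    p = q) ->
  A !=set0 -> weakly_compact A -> continuous l ->
  exists2 p, extreme_points A p & forall q, A q -> l q <= l p.
Proof.
move=> sep A0 cA lc.
have [p0 Ap0 pmax] := weakly_compact_argmax A0 cA lc.
pose B : set E := A `&` [set p | l p0 <= l p].
have cB : weakly_compact B.
  by apply: compact_closedI => //; exact: weakly_closed_ge.
have [|p [[Ap lp] pext]] := weakly_compact_extreme_point sep _ cB.
  by exists p0; split => //=.
exists p; last by move=> q Aq; apply: le_trans (pmax _ Aq) lp.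
split => // q r t Aq Ar t01 pE.
have lq := pmax _ Aq; have lr := pmax _ Ar.
have lm : l p0 <= t * l q + (1 - t) * l r.
  by rewrite (le_trans lp)// pE linearD !linearZ.
by apply: (pext q r t _ _ t01 pE); split => //=; nra.
Qed.

Lemma convex_setP (R : realType) (E : lmodType R) (A : set E) :
  convex_set A <-> forall (p q : E) (t : R), A p -> A q -> 0 <= t <= 1 ->
    A (t *: p + (1 - t) *: q).
Proof.
split=> [cA p q t Ap Aq /andP[t0 t1]|cA p q t /set_mem Ap /set_mem Aq].
  exact: set_mem (cA p q (Itv01 t0 t1) (mem_set Ap) (mem_set Aq)).
by apply/mem_set/cA => //; rewrite ge0 le1.
Qed.

(** * The Hilbert space of affine functions *)

Section Codifferentials.
Variables (R : realType) (H : completeNormedModType R).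
Variable ip : {dot H for (@idfun R)}.
Local Notation RH := (R^o * H)%type.
Implicit Types (p q r u : RH) (a b c : R).

Lemma dotC (v w : H) : ip v w = ip w v.
Proof. by rewrite (hermC ip) /= expr0 mul1r. Qed.

Lemma pdotC p q : pdot ip p q = pdot ip q p.
Proof. by rewrite /pdot mulrC dotC. Qed.

Lemma pdotDl p q r : pdot ip (p + q) r = pdot ip p r + pdot ip q r.
Proof. by rewrite /pdot /= mulrDl (linearDl ip) addrACA. Qed.

Lemma pdotZl a p q : pdot ip (a *: p) q = a * pdot ip p q.
Proof. by rewrite /pdot /= (linearZl_LR ip) mulrDr mulrA. Qed.

Lemma pdotNl p q : pdot ip (- p) q = - pdot ip p q.
Proof. by rewrite -scaleN1r pdotZl mulN1r. Qed.

Lemma pdotDr p q r : pdot ip r (p + q) = pdot ip r p + pdot ip r q.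
Proof. by rewrite !(pdotC r) pdotDl. Qed.

Lemma pdotZr a p q : pdot ip q (a *: p) = a * pdot ip q p.
Proof. by rewrite !(pdotC q) pdotZl. Qed.

Lemma pdotNr p q : pdot ip q (- p) = - pdot ip q p.
Proof. by rewrite !(pdotC q) pdotNl. Qed.

Definition pdotE := (pdotDl, pdotDr, pdotNl, pdotNr, pdotZl, pdotZr).

Lemma pdot_gt0 p : p != 0 -> 0 < pdot ip p p.
Proof.
case: p => a v; rewrite /pdot /= => nz.
have [v0|v0] := eqVneq v 0.
  have a0 : a != 0 by apply: contraNneq nz => a0; rewrite v0 a0.
  by rewrite v0 (linear0r ip) addr0 -expr2 exprn_even_gt0.
by rewrite ltr_wpDl ?neq0_dnorm_gt0// -[_ * _]expr2 sqr_ge0.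
Qed.

Lemma pdot_ge0 p : 0 <= pdot ip p p.
Proof.
have [->|/pdot_gt0/ltW//] := eqVneq p 0.
by rewrite -(scale0r (0 : RH)) pdotZl mul0r.
Qed.

Lemma pnorm_ge0 p : 0 <= pnorm ip p. Proof. exact: sqrtr_ge0. Qed.

Lemma sqr_pnorm p : pnorm ip p ^+ 2 = pdot ip p p.
Proof. by rewrite sqr_sqrtr// pdot_ge0. Qed.

Lemma pnormN p : pnorm ip (- p) = pnorm ip p.
Proof. by rewrite /pnorm !pdotE opprK. Qed.

Lemma pdot_CauchySchwarz p q : `|pdot ip p q| <= pnorm ip p * pnorm ip q.
Proof.
rewrite -(@ler_pXn2r _ 2)// ?nnegrE ?mulr_ge0 ?pnorm_ge0//.
rewrite real_normK ?num_real// exprMn !sqr_pnorm.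
have [->|/pdot_gt0 q0] := eqVneq q 0.
  by rewrite -(scale0r (0 : RH)) !pdotE !mul0r expr0n mulr0.
have := pdot_ge0 (pdot ip q q *: p - pdot ip p q *: q).
rewrite !pdotE (pdotC q p).
set s := pdot ip p q; set P := pdot ip p p; set Q := pdot ip q q.
rewrite -/Q in q0; nra.
Qed.

Lemma pdot_le p q : pdot ip p q <= pnorm ip p * pnorm ip q.
Proof. exact: le_trans (ler_norm _) (pdot_CauchySchwarz p q). Qed.

Lemma pdot_ge p q : - (pnorm ip p * pnorm ip q) <= pdot ip p q.
Proof. by have := pdot_le (- p) q; rewrite pnormN pdotNl lerNl. Qed.

Lemma ler_pnormD p q : pnorm ip (p + q) <= pnorm ip p + pnorm ip q.
Proof.
rewrite -(@ler_pXn2r _ 2)// ?nnegrE ?addr_ge0 ?pnorm_ge0//.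
rewrite sqrrD !sqr_pnorm !pdotE (pdotC q p).
by have := pdot_le p q; lra.
Qed.

Lemma fst_le_pnorm p : `|p.1| <= pnorm ip p.
Proof.
rewrite -(@ler_pXn2r _ 2)// ?nnegrE ?pnorm_ge0//.
rewrite real_normK ?num_real// sqr_pnorm /pdot expr2 lerDl.
by have := pdot_ge0 (0, p.2); rewrite /pdot /= mul0r add0r.
Qed.

(** The squared norm of [p + t *: d] is a quadratic in [t] whose derivative at
    [0] is twice the product in question; a negative derivative would make the
    norm smaller at the step [t] chosen below. *)
Lemma pdot_variational p d :
  (forall t, 0 <= t <= 1 -> pnorm ip p <= pnorm ip (p + t *: d)) ->
  0 <= pdot ip p d.
Proof.
move=> pmin; rewrite leNgt; apply/negP => pd0.
have D0 := pdot_ge0 d.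
pose t := - pdot ip p d / (pdot ip d d - pdot ip p d).
have D1 : 0 < pdot ip d d - pdot ip p d by lra.
have t0 : 0 < t by rewrite /t divr_gt0// oppr_gt0.
have t1 : t <= 1 by rewrite /t ler_pdivrMr// mul1r; lra.
have tE : t * (pdot ip d d - pdot ip p d) = - pdot ip p d.
  by rewrite /t divfK// gt_eqF.
have := pmin t; rewrite ltW//= t1 => /(_ isT).
rewrite -(@ler_pXn2r _ 2)// ?nnegrE ?pnorm_ge0//.
rewrite !sqr_pnorm !pdotE (pdotC d p) => h.
have {}h : 0 <= t * (2 * pdot ip p d + t * pdot ip d d) by lra.
rewrite pmulr_rge0// in h; nra.
Qed.

Hypothesis ip_norm : forall x : H, `|x| ^+ 2 = ip x x.

Lemma snd_le_pnorm p : `|p.2| <= pnorm ip p.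
Proof.
rewrite -(@ler_pXn2r _ 2)// ?nnegrE ?pnorm_ge0//.
by rewrite sqr_pnorm ip_norm /pdot lerDr -expr2 sqr_ge0.
Qed.

Lemma pnorm_le_norm p : pnorm ip p <= `|p.1| + `|p.2|.
Proof.
rewrite -(@ler_pXn2r _ 2)// ?nnegrE ?addr_ge0 ?pnorm_ge0//.
rewrite sqrrD sqr_pnorm ip_norm real_normK ?num_real//.
by rewrite /pdot -expr2 addrAC lerDl mulrn_wge0// mulr_ge0.
Qed.

Lemma pdot_functional u :
  exists2 l : {linear RH -> R^o}, continuous l & forall p, l p = pdot ip u p.
Proof.
have lin : linear (pdot ip u : RH -> R^o).
  by move=> a p q; rewrite pdotDr pdotZr.
pose l : {linear RH -> R^o} := HB.pack (pdot ip u : RH -> R^o)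
  (GRing.isLinear.Build R RH R^o *:%R (pdot ip u : RH -> R^o) lin).
exists l => //; apply: bounded_linear_continuous.
exists (pnorm ip u * 2); split; first exact: num_real.
move=> M uM; near=> p.
have p1 : `|p| < 1 by near: p; exact: (@cvgr0_norm_lt _ RH).
rewrite /= (le_trans (pdot_CauchySchwarz u p))// (le_trans _ (ltW uM))//.
rewrite ler_wpM2l ?pnorm_ge0// (le_trans (pnorm_le_norm p))//.
move: p1; rewrite prod_normE gt_max => /andP[]; lra.
Unshelve. all: by end_near. Qed.

(** The functional attached to [p - q] takes different values at [p] and [q]
    unless these coincide. *)
Lemma pdot_separates p q :
  (forall l : {linear RH -> R^o}, continuous l -> l p = l q) -> p = q.
Proof.
move=> pq; have [l lc lE] := pdot_functional (p - q).
have /eqP := pq l lc; rewrite !lE -subr_eq0 -pdotNr -pdotDr => e.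
by apply/eqP; rewrite -subr_eq0; apply: contraTT e => /pdot_gt0/lt0r_neq0.
Qed.

Lemma pdot_extreme_argmax (A : set RH) u :
  A !=set0 -> weakly_compact A ->
  exists2 p, extreme_points A p & forall q, A q -> pdot ip u q <= pdot ip u p.
Proof.
move=> A0 cA; have [l lc lE] := pdot_functional u.
have [p pe pmax] := weakly_compact_extreme_argmax pdot_separates A0 cA lc.
by exists p => // q Aq; rewrite -!lE; exact: pmax.
Qed.

Lemma pdot_argmax (A : set RH) u :
  A !=set0 -> weakly_compact A ->
  exists2 p, A p & forall q, A q -> pdot ip u q <= pdot ip u p.
Proof.
by move=> A0 /(pdot_extreme_argmax u A0)[p [Ap _] ?]; exists p.
Qed.

Lemma weakly_closed_pdot_ge u c :
  closed ([set p | c <= pdot ip u p] : set (weak_space RH)).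
Proof.
have [l lc lE] := pdot_functional u.
by under eq_set => p do rewrite -lE; exact: weakly_closed_ge.
Qed.

Lemma closed_pdot_ge u c : closed ([set p | c <= pdot ip u p] : set RH).
Proof.
have [l lc lE] := pdot_functional u.
under eq_set => p do rewrite -lE.
by apply: (@preimage_closed _ R^o l [set y | c <= y]); last exact: closed_ge.
Qed.

(** The uniform boundedness principle, applied to the functionals that the
    second components of [A] define on [H]. *)
Lemma weakly_compact_bounded (A : set RH) :
  weakly_compact A -> exists2 K, 0 <= K & forall p, A p -> pnorm ip p <= K.
Proof.
move=> cA.
have [[a Aa]|A0] := pselect (A !=set0); last first.
  by exists 0 => // p Ap; case: A0; exists p.
have A0 : A !=set0 by exists a.
have bnd u : exists M, forall p, A p -> `|pdot ip u p| <= M.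
  have [p Ap pmax] := pdot_argmax u A0 cA.
  have [q Aq qmax] := pdot_argmax (- u) A0 cA.
  exists (`|pdot ip u p| + `|pdot ip u q|) => r Ar.
  have := qmax r Ar; have := pmax r Ar; rewrite !pdotNl.
  have := ler_norm (pdot ip u p); have := ler_norm (- pdot ip u q).
  rewrite normrN ler_norml => h1 h2 h3 h4.
  have := normr_ge0 (pdot ip u p); have := normr_ge0 (pdot ip u q).
  by move=> h5 h6; apply/andP; split; lra.
have [M1 A1] := bnd (1, 0).
pose F : set (H -> R^o) := [set (fun v => ip p.2 v : R^o) | p in A].
have [|x|M2 A2] := @Banach_Steinhauss R H R^o F _ _ 1.
- move=> _ [p Ap <-]; split.
    move=> r; exists (`|p.2| * r) => x xr.
    have := pdot_CauchySchwarz (0, p.2) (0, x).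
    rewrite /pdot /= mul0r add0r => h; apply: (le_trans h).
    have n0 (y : H) : pnorm ip (0, y) <= `|y|.
      by have := pnorm_le_norm (0, y); rewrite /= normr0 add0r.
    by rewrite ler_pM ?pnorm_ge0// (le_trans (n0 _)).
  by move=> c x y; rewrite linearDr linearZr_LR.
- have [M AM] := bnd (0, x).
  exists M => _ [p Ap <-]; have := AM p Ap.
  by rewrite /pdot /= mul0r add0r dotC.
have bnd2 p : A p -> `|p.2| <= `|M2|.
  move=> Ap; have [->|nz] := eqVneq p.2 0; first by rewrite normr0.
  have n0 : 0 < `|p.2| by rewrite normr_gt0.
  have := A2 _ (imageP _ Ap) (`|p.2|^-1 *: p.2).
  rewrite normrZ normfV normr_id mulVf ?gt_eqF// => /(_ (lexx _)) /=.
  rewrite linearZr_LR /= -ip_norm expr2 mulKf ?gt_eqF// normr_id.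
  by move=> h; rewrite (le_trans h)// ler_norm.
exists (`|M1| + `|M2|); first by rewrite addr_ge0.
move=> p Ap; rewrite (le_trans (pnorm_le_norm p))// lerD ?bnd2//.
have := A1 p Ap; rewrite /pdot /= mul1r (linear0l ip) addr0 => h.
by rewrite (le_trans h)// ler_norm.
Qed.

(** * Norm minimization and separation *)

(** The norm is a supremum of functionals, hence weakly lower semicontinuous. *)
Lemma weakly_closed_pnorm_le k c :
  closed ([set p | pnorm ip (p + k) <= c] : set (weak_space RH)).
Proof.
have [c0|c0] := leP 0 c; last first.
  suff -> : [set p | pnorm ip (p + k) <= c] = set0 by exact: closed0.
  by apply/seteqP; split => // p /=; have := pnorm_ge0 (p + k); lra.
have -> : [set p | pnorm ip (p + k) <= c] = \bigcap_(u in [set: RH])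
    [set p | - (c * pnorm ip u) - pdot ip u k <= pdot ip u p].
  apply/seteqP; split => p /= pk.
    move=> u _ /=; have := pdot_ge u (p + k); rewrite pdotDr.
    by have := ler_wpM2r (pnorm_ge0 u) pk; lra.
  have := pk (- (p + k)) I; rewrite /= pnormN !pdotNl => h.
  have {}h : pdot ip (p + k) (p + k) <= c * pnorm ip (p + k).
    by rewrite pdotDr; lra.
  rewrite -sqr_pnorm expr2 in h.
  have := pnorm_ge0 (p + k); rewrite le_eqVlt => /orP[/eqP <- //|n0].
  by rewrite -(ler_pM2r n0).
by apply: (@closed_bigI (weak_space RH) RH setT) => u _; exact: weakly_closed_pdot_ge.
Qed.

Lemma pnorm_argmin (A : set RH) k :
  A !=set0 -> weakly_compact A ->
  exists2 p, A p & forall q, A q -> pnorm ip (p + k) <= pnorm ip (q + k).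
Proof.
move=> A0 cA.
pose W c : set (weak_space RH) := ~` [set p | pnorm ip (p + k) <= c].
have [||p [Ap np]] := @compact_open_chain (weak_space RH) A
    [set W (pnorm ip (q + k)) | q in A] cA A0.
- move=> _ _ [q _ <-] [r _ <-].
  have [h|/ltW h] := leP (pnorm ip (q + k)) (pnorm ip (r + k)); [right|left];
    by move=> x nx hx; apply: nx => /=; exact: le_trans hx h.
- move=> _ [q Aq <-]; split.
    by apply: closed_openC; exact: weakly_closed_pnorm_le.
  by exists q; split => // /(_ (lexx _)).
exists p => // q Aq; apply: contrapT => h.
by apply: np; exists (W (pnorm ip (q + k))) => //; exists q.
Qed.

Lemma shift_base p q k : q + k = p + k + (q - p).
Proof. by rewrite addrAC [p + _]addrC subrK. Qed.

Lemma segment_shift p q k t :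
  p + k + t *: (q - p) = (t *: q + (1 - t) *: p) + k.
Proof.
rewrite scalerBr scalerBl scale1r [LHS]addrAC; congr (_ + _).
by rewrite addrCA.
Qed.

(** The separating functional is the least norm element of [A + k], which is
    nonzero; the bound [c] is the square of its norm. *)
Lemma pdot_separation (A : set RH) k :
  A !=set0 -> convex_set A -> weakly_compact A -> ~ A (- k) ->
  exists u, exists2 c, 0 < c & forall q, A q -> c <= pdot ip u (q + k).
Proof.
move=> A0 /convex_setP cvA cA nAk.
have [p Ap pmin] := pnorm_argmin k A0 cA.
exists (p + k), (pdot ip (p + k) (p + k)).
  apply: pdot_gt0; apply: contra_notN nAk => /eqP/addr0_eq.
  by move=> <-; rewrite opprK.
move=> q Aq; rewrite (shift_base p q) [leRHS]pdotDr lerDl.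
apply: pdot_variational => t t01.
by rewrite segment_shift; apply: pmin; exact: cvA.
Qed.

(** A closed half-space is closed and convex. *)
Lemma closure_convex_hull_ge (T : set RH) u c :
  (forall q, T q -> c <= pdot ip u q) ->
  forall q, closure (convex_hull T) q -> c <= pdot ip u q.
Proof.
move=> Tc.
have hull q : convex_hull T q -> c <= pdot ip u q.
  apply: (@smallest_sub _ _ T [set q | c <= pdot ip u q]) => //.
  apply/convex_setP => p r t /= cp cr /andP[t0 t1].
  by rewrite pdotDr !pdotZr; nra.
move=> q /(closure_subset (B := [set q | c <= pdot ip u q]) hull).
exact: closed_pdot_ge.
Qed.

(** Moving from the element of least norm towards any point of the set cannot
    decrease the norm. *)
Lemma least_norm_variational (T : set RH) z p q :
  argmin [set r + z | r in closure (convex_hull T)] (pnorm ip) p ->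
  T q -> pdot ip p p <= pdot ip p (q + z).
Proof.
move=> [[r clr <-] pmin] Tq.
have hullT : T `<=` convex_hull T by exact: sub_smallest.
have cvhull : convex_set (convex_hull T).
  apply/convex_setP => x y t hx hy t01 B [cB TB].
  by move/convex_setP: (cB); apply => //; [exact: hx|exact: hy].
rewrite (shift_base r q) [leRHS]pdotDr lerDl.
apply: pdot_variational => t t01; rewrite segment_shift; apply: pmin.
exists (t *: q + (1 - t) *: r) => //.
pose g (x : RH) : RH := t *: q + (1 - t) *: x.
have gc : continuous g.
  by move=> x; apply: cvgD; [exact: cvg_cst|apply: cvgZr; exact: cvg_id].
have clg : closed (g @^-1` closure (convex_hull T)).
  apply: preimage_closed; first by move=> x _; exact: gc.
  exact: closed_closure.
apply: clg; apply: closure_subset _ _ clr => x hx /=.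
apply: subset_closure; move/convex_setP: cvhull; apply => //.
exact: hullT.
Qed.

(** * Hausdorff continuity *)

Lemma hausdorff_near (F : H -> set RH) x e :
  hausdorff_continuous_at ip F x -> 0 < e ->
  \forall y \near x,
    (forall p, F y p -> exists2 q, F x q & pnorm ip (p - q) < e) /\
    (forall q, F x q -> exists2 p, F y p & pnorm ip (q - p) < e).
Proof.
move=> Fx e0.
have excess (A B : set RH) : (ereal_sup
    [set ereal_inf [set (pnorm ip (p - q))%:E | q in B] | p in A] < e%:E)%E ->
    forall p, A p -> exists2 q, B q & pnorm ip (p - q) < e.
  move=> supe p Ap.
  have : (ereal_inf [set (pnorm ip (p - q))%:E | q in B] < e%:E)%E.
    by apply: le_lt_trans supe; apply: ereal_sup_ubound; exists p.
  by move=> /ereal_inf_lt[_ [q Bq <-]]; rewrite lte_fin => ?; exists q.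
have : \forall y \near x, (hausdorff_dist ip (F y) (F x) < e%:E)%E.
  apply: (Fx [set d | (d < e%:E)%E]); apply: open_nbhs_nbhs; split.
    exact: open_ereal_lt_ereal.
  by rewrite /= lte_fin.
apply: filterS => y; rewrite /hausdorff_dist gt_max => /andP[h1 h2].
by split; exact: excess.
Qed.

Lemma hausdorff_near_bounded (F : H -> set RH) x K :
  hausdorff_continuous_at ip F x -> (forall q, F x q -> pnorm ip q <= K) ->
  \forall y \near x, forall p, F y p -> pnorm ip p <= K + 1.
Proof.
move=> Fx FK; apply: filterS (hausdorff_near Fx ltr01) => y [h _] p /h[q Fq pq].
rewrite -[p](subrK q) (le_trans (ler_pnormD _ _))// addrC lerD ?FK//.
exact: ltW.
Qed.

(** The extreme point [z] maximizes [u - M (1, 0)]: comparing with a point of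
    [du y] close to [k] shows that [z] lies almost as far as [k] in the
    direction [u], while a large [M] forces its first component to be small. *)
Lemma extreme_point_near (dl du : H -> set RH) x u k c eta :
  hausdorff_continuous_at ip dl x -> hausdorff_continuous_at ip du x ->
  (\forall y \near x, du y !=set0 /\ weakly_compact (du y)) ->
  weakly_compact (du x) ->
  (forall z, du x z -> 0 <= z.1) -> du x k -> k.1 = 0 -> 0 < c -> 0 < eta ->
  (forall q, dl x q -> c <= pdot ip u (q + k)) ->
  \forall y \near x, exists z, [/\ extreme_points (du y) z, z.1 <= eta &
    forall q, dl y q -> c / 2 <= pdot ip u (q + z)].
Proof.
move=> dlx dux duy cdu du_ge0 duk k1 c0 eta0 sep.
have [K K0 duK] := weakly_compact_bounded cdu.
(* On du x the functional u varies by at most 2 n K, which is at most half of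
   M eta: this keeps the first component of a maximizer below eta. The radius e
   keeps the errors, all at most 4 (n + M) e, below c / 2 and M eta / 2. *)
set n := pnorm ip u; have n0 : 0 <= n by exact: pnorm_ge0.
pose M := 4 * n * K / eta + 1.
have M0 : 0 < M by rewrite ltr_wpDl// divr_ge0 ?mulr_ge0// ltW.
have Meta : M * eta = 4 * n * K + eta.
  by rewrite /M mulrDl mul1r divfK// gt_eqF.
have nM : 0 < 8 * (n + M) by lra.
pose e := Num.min c (M * eta) / (8 * (n + M)).
have m0 : 0 < Num.min c (M * eta) by rewrite lt_min c0 mulr_gt0.
have e0 : 0 < e by rewrite divr_gt0.
have eE : 8 * (n + M) * e = Num.min c (M * eta).
  by rewrite /e mulrC divfK// gt_eqF.
have ec : 8 * (n + M) * e <= c by rewrite eE ge_min lexx.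
have eeta : 8 * (n + M) * e <= M * eta by rewrite eE ge_min lexx orbT.
have ne : 0 <= n * e by rewrite mulr_ge0// ltW.
have Me : 0 < M * e by rewrite mulr_gt0.
have u_close p q : pnorm ip (p - q) < e ->
    pdot ip u p <= pdot ip u q + n * e.
  move=> /ltW pq; rewrite -lerBlDl -pdotNr -pdotDr.
  by rewrite (le_trans (pdot_le _ _))// ler_wpM2l.
have fst_close p q : pnorm ip (p - q) < e -> p.1 <= q.1 + e.
  move=> /ltW pq; rewrite -lerBlDl.
  by rewrite (le_trans (ler_norm _))// (le_trans (fst_le_pnorm (p - q))).
have dle := hausdorff_near dlx e0; have due := hausdorff_near dux e0.
apply: filterS3 dle due duy => y [dle _] [due due'] [du0 cduy].
have [z zext zmax] := pdot_extreme_argmax (u - M *: (1, 0)) du0 cduy.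
have [z' duz' kz'] := due' _ duk.
have [z'' duz'' zz''] := due z zext.1.
have pdot1 p : pdot ip (1, 0) p = p.1.
  by rewrite /pdot /= (linear0l ip) addr0 mul1r.
have := zmax z' duz'; rewrite !(pdotDl, pdotNl, pdotZl) !pdot1.
have := u_close _ _ kz'; have := u_close _ _ zz''.
have z'k : pnorm ip (z' - k) < e by rewrite -opprB pnormN.
have z''z : pnorm ip (z'' - z) < e by rewrite -opprB pnormN.
have := fst_close _ _ z'k; have fz := fst_close _ _ zz''.
have fz'' := fst_close _ _ z''z.
rewrite k1 add0r => h1 h2 h3 h4.
have z''0 := du_ge0 _ duz''.
have uz'' : pdot ip u z'' <= n * K.
  by rewrite (le_trans (pdot_le _ _))// ler_wpM2l ?duK.
have uk : - (n * K) <= pdot ip u k.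
  by rewrite (le_trans _ (pdot_ge _ _))// lerN2 ler_wpM2l ?duK.
have Mz' : M * z'.1 <= M * e by rewrite ler_pM2l.
have Mz'' : M * z''.1 <= M * z.1 + M * e by rewrite -mulrDr ler_pM2l.
have Mz''0 : 0 <= M * z''.1 by rewrite mulr_ge0// ltW.
exists z; split => //.
  rewrite -(ler_pM2l M0); lra.
move=> q /dle[q'' dlq'' qq''].
have q''q : pnorm ip (q'' - q) < e by rewrite -opprB pnormN.
have := u_close _ _ q''q; have := sep q'' dlq''.
by rewrite !pdotDr; lra.
Qed.

(** * Decrease of the codifferential model *)

Lemma set_maxE (A : set R) m : A m -> ubound A m -> set_max A = m.
Proof.
move=> Am ubm; rewrite /set_max.
have [Ax ubx] := xgetPex 0 (ex_intro (fun m => A m /\ ubound A m) m (conj Am ubm)).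
by apply/eqP; rewrite eq_le ubm//= ubx.
Qed.

Lemma set_minE (A : set R) m : A m -> lbound A m -> set_min A = m.
Proof.
move=> Am lbm; rewrite /set_min.
have [Ax lbx] := xgetPex 0 (ex_intro (fun m => A m /\ lbound A m) m (conj Am lbm)).
by apply/eqP; rewrite eq_le lbm// lbx.
Qed.

Lemma pdot_pair a (v : H) p : pdot ip (1, a *: v) p = p.1 + a * ip p.2 v.
Proof. by rewrite /pdot /= mul1r (linearZl_LR ip) dotC. Qed.

Lemma set_max_affine (A : set RH) a (v : H) :
  A !=set0 -> weakly_compact A ->
  exists2 q, extreme_points A q &
    set_max [set p.1 + a * ip p.2 v | p in A] = q.1 + a * ip q.2 v /\
    forall p, A p -> p.1 + a * ip p.2 v <= q.1 + a * ip q.2 v.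
Proof.
move=> A0 cA; have [q qext qmax] := pdot_extreme_argmax (1, a *: v) A0 cA.
have {}qmax p : A p -> p.1 + a * ip p.2 v <= q.1 + a * ip q.2 v.
  by move=> /qmax; rewrite !pdot_pair.
exists q => //; split => //; apply: set_maxE.
  by exists q => //; case: qext.
by move=> _ [p Ap <-]; exact: qmax.
Qed.

Lemma set_min_affine (A : set RH) a (v : H) :
  A !=set0 -> weakly_compact A ->
  exists2 q, A q &
    set_min [set p.1 + a * ip p.2 v | p in A] = q.1 + a * ip q.2 v /\
    forall p, A p -> q.1 + a * ip q.2 v <= p.1 + a * ip p.2 v.
Proof.
move=> A0 cA; have [q Aq qmax] := pdot_argmax (- (1, a *: v)) A0 cA.
have {}qmin p : A p -> q.1 + a * ip q.2 v <= p.1 + a * ip p.2 v.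
  by move=> /qmax; rewrite !pdotNl !pdot_pair lerN2.
exists q => //; split => //; apply: set_minE; first by exists q.
by move=> _ [p Ap <-]; exact: qmin.
Qed.

Lemma normalized_le0 (A B : set RH) p :
  A !=set0 -> weakly_compact A -> normalized A B -> A p -> p.1 <= 0.
Proof.
move=> A0 cA [nA _] Ap; have [q [Aq _] [qE qmax]] := set_max_affine 0 0 A0 cA.
have := qmax p Ap; rewrite -qE !mul0r addr0.
by under eq_imagel do rewrite mul0r addr0; rewrite nA.
Qed.

Lemma normalized_ge0 (A B : set RH) p :
  B !=set0 -> weakly_compact B -> normalized A B -> B p -> 0 <= p.1.
Proof.
move=> B0 cB [_ nB] Bp; have [q Bq [qE qmin]] := set_min_affine 0 0 B0 cB.
have := qmin p Bp; rewrite -qE !mul0r addr0.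
by under eq_imagel do rewrite mul0r addr0; rewrite nB.
Qed.

Lemma normalized_extreme0 (A B : set RH) :
  A !=set0 -> weakly_compact A -> normalized A B ->
  exists2 q, extreme_points A q & q.1 = 0.
Proof.
move=> A0 cA [nA _]; have [q qe [qE qmax]] := set_max_affine 0 0 A0 cA.
exists q => //; move: qE; under eq_imagel do rewrite mul0r addr0.
by rewrite nA mul0r addr0.
Qed.

(** The maximum over [A] is attained at an extreme point [q]. If [q] belongs to
    [T], the variational inequality for the least norm element [p] gives the
    decrease; otherwise the first component of [q] is less than [- nu0], which
    outweighs the other terms once [b] is small. *)
Lemma model_decrease (A B T : set RH) z p a s b nu0 kappa N eta :
  A !=set0 -> weakly_compact A -> B !=set0 -> weakly_compact B ->
  (forall q, A q -> q.1 <= 0) ->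
  [set q | extreme_points A q /\ - nu0 <= q.1] `<=` T ->
  B z -> 0 <= z.1 <= eta ->
  argmin [set q + z | q in closure (convex_hull T)] (pnorm ip) p ->
  kappa <= pdot ip p p -> pnorm ip p <= N ->
  (forall q, A q -> pnorm ip (q + z) <= N) ->
  b = a * s -> 0 <= b -> b * N <= 1 -> b * (N ^+ 2 + kappa) <= nu0 ->
  set_max [set q.1 + a * ip q.2 (- (s *: p.2)) | q in A] +
  set_min [set q.1 + a * ip q.2 (- (s *: p.2)) | q in B] <=
    - (b * kappa) + 2 * eta.
Proof.
move=> A0 cA B0 cB A_le0 extT Bz /andP[z0 zeta] pmin kp pN AN bE b0 bN bnu.
set v := - (s *: p.2).
have [q qext [-> _]] := set_max_affine a v A0 cA.
have [r Br [-> rmin]] := set_min_affine a v B0 cB.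
have {rmin} rz := rmin z Bz.
have avE w : a * ip w v = - (b * ip w p.2).
  by rewrite /v (linearNr ip) (linearZr_LR ip) /= bE mulrN mulrA.
rewrite !avE in rz *; pose S : R := q.1 + z.1.
have SE : S = q.1 + z.1 by [].
have qzE : b * pdot ip p (q + z) = b * S * p.1 + b * ip q.2 p.2 + b * ip z.2 p.2.
  by rewrite pdotC /pdot /= (linearDl ip) /S; ring.
have q0 : q.1 <= 0 by apply: A_le0; exact: qext.1.
have bkp : b * kappa <= b * pdot ip p p by rewrite ler_wpM2l.
have N0 : 0 <= N by exact: le_trans (pnorm_ge0 p) pN.
have bp : `|b * p.1| <= 1.
  rewrite normrM (ger0_norm b0) (le_trans _ bN)// ler_wpM2l//.
  exact: le_trans (fst_le_pnorm p) pN.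
move: bp; rewrite ler_norml => /andP[bp1 bp2].
suff : S - b * ip q.2 p.2 - b * ip z.2 p.2 <= - (b * kappa) + 2 * eta by lra.
have [qnu|qnu] := leP (- nu0) q.1.
  have := least_norm_variational pmin (extT q (conj qext qnu)).
  move=> /(ler_wpM2l b0); rewrite qzE => h.
  suff : S * (1 + b * p.1) <= 2 * eta by lra.
  rewrite SE; nra.
have p2N : pnorm ip (0, p.2) <= N.
  rewrite (le_trans (pnorm_le_norm _))//= normr0 add0r.
  exact: le_trans (snd_le_pnorm p) pN.
have : - (b * N ^+ 2) <= b * pdot ip (q + z) (0, p.2).
  rewrite -mulrN ler_wpM2l// (le_trans _ (pdot_ge _ _))// lerN2 expr2.
  by rewrite ler_pM ?pnorm_ge0// AN//; exact: qext.1.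
by rewrite /pdot /= mulr0 add0r (linearDl ip) /=; lra.
Qed.

(** * Uniform descent near a non-stationary point *)

Definition codiff_on (U : set H) (f : H -> R) (dl du : H -> set RH) :=
  (forall y, U y -> is_codifferential ip f y (dl y) (du y)) /\
  (forall y, U y -> normalized (dl y) (du y)).

(** The step length [b] is fixed before the neighbourhood of [xs], and the bound
    [eta] on the first component of [z] only after [b], because the loss [2 eta]
    in the decrease of the model has to be small compared with [b kappa]. *)
Lemma descent_near (U : set H) (f : H -> R) (dl du : H -> set RH) xs w
    nu0 mu0 a0 :
  codiff_on U f dl du -> U xs ->
  hausdorff_continuous_at ip dl xs -> hausdorff_continuous_at ip du xs ->
  (exists C : set H, [/\ nbhs xs C, C `<=` U &
     uniformly_approximates ip U f dl du C]) ->
  du xs (0, w) -> ~ dl xs (- (0, w)) ->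
  0 < nu0 -> 0 < mu0 -> 0 < a0 ->
  exists2 D, 0 < D & \forall y \near xs, exists z,
    [/\ extreme_points (du y) z, z.1 <= mu0 &
     forall T p, T `<=` dl y ->
       [set q | extreme_points (dl y) q /\ - nu0 <= q.1] `<=` T ->
       argmin [set q + z | q in closure (convex_hull T)] (pnorm ip) p ->
       exists b, [/\ 0 <= b, b <= a0, U (y - b *: p.2) &
                     f (y - b *: p.2) <= f y - D]].
Proof.
move=> [codiff norml] Uxs dlx dux [C [xsC CU [r [r0 CrU approx]]]] duw ndlw.
move=> nu00 mu00 a00.
have [[dl0 cvdl cdl] [du0 _ cdu] _ _] := codiff _ Uxs.
have [u [c c0 sep]] := pdot_separation dl0 cvdl cdl ndlw.
have u0 : 0 < pnorm ip u.
  rewrite lt_neqAle pnorm_ge0 andbT eq_sym; apply/eqP => u0.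
  have [q dlq] := dl0; have := le_trans (sep q dlq) (pdot_le u _).
  by rewrite u0 mul0r leNgt c0.
(* <u, p> >= c / 2 implies <p, p> >= kappa by the Cauchy-Schwarz inequality. *)
pose kappa := (c / 2 / pnorm ip u) ^+ 2.
have kappa0 : 0 < kappa by rewrite exprn_gt0// !divr_gt0.
have [K1 K10 dlK] := weakly_compact_bounded cdl.
have [K2 K20 duK] := weakly_compact_bounded cdu.
pose N := K1 + 1 + (K2 + 1).
have N0 : 0 < N by rewrite /N; lra.
(* The factor s scales a vector of norm at most N into the ball of radius r. *)
pose s := r / N.
have s0 : 0 < s by rewrite divr_gt0.
have e0 : 0 < s * kappa / 4 by rewrite divr_gt0// mulr_gt0.
have N20 : 0 < N ^+ 2 + kappa by rewrite addr_gt0// exprn_gt0.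
pose m := Num.min 1 (Num.min (N^-1 / s) (Num.min (nu0 / (N ^+ 2 + kappa) / s)
  (a0 / s))).
have m0 : 0 < m by rewrite !lt_min ltr01 !divr_gt0// invr_gt0.
have [a [a_gt0 aapprox am]] : exists a, [/\ 0 < a,
    forall x Dx, C x -> closed_ball_ Num.norm 0 r Dx ->
      `|codiff_error ip f (dl x) (du x) x a Dx| < s * kappa / 4 & a <= m].
  have [a [[h1 h2] h3]] := filter_ex (filterI
    (filterI (nbhs_right_gt 0) (approx _ e0)) (nbhs_right_le m0)).
  by exists a.
move: am; rewrite !le_min !ler_pdivlMr// => /and4P[a1 aN anu aa0].
pose b := a * s.
have b0 : 0 < b by rewrite mulr_gt0.
have bN : b * N <= 1 by rewrite -[leRHS](mulVf (lt0r_neq0 N0)) ler_pM2r.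
have bkappa : 0 < b * kappa by rewrite mulr_gt0.
exists (b * kappa / 2); first by rewrite divr_gt0.
pose eta := Num.min (b * kappa / 8) mu0.
have eta0 : 0 < eta by rewrite lt_min mu00 divr_gt0.
have Unear : \forall y \near xs, U y by exact: filterS xsC.
have duy : \forall y \near xs, du y !=set0 /\ weakly_compact (du y).
  by apply: filterS Unear => y /codiff[_ []].
have du_ge0 y z : U y -> du y z -> 0 <= z.1.
  move=> Uy; have [_ [] ? _ ? _ _] := codiff _ Uy.
  exact: normalized_ge0 (norml _ Uy).
have zex := extreme_point_near dlx dux duy cdu (du_ge0 _ ^~ Uxs) duw erefl c0
  eta0 sep.
apply: filterS3 (filterI xsC zex) (hausdorff_near_bounded dlx dlK)
  (hausdorff_near_bounded dux duK) => y [Cy [z [zext zeta zsep]]] dlyK duyK.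
have Uy := CU _ Cy.
have [[dly0 _ cdly] [duy0 _ cduy] _ _] := codiff _ Uy.
exists z; split => //; first by rewrite (le_trans zeta)// ge_min lexx orbT.
move=> T p Tdl extT pmin.
have qzN q : dl y q -> pnorm ip (q + z) <= N.
  move=> dlq; rewrite (le_trans (ler_pnormD _ _))// lerD ?dlyK// duyK//.
  exact: zext.1.
have [q0 q0ext q01] := normalized_extreme0 dly0 cdly (norml _ Uy).
have pN : pnorm ip p <= N.
  apply: le_trans (qzN q0 q0ext.1); apply: (pmin.2); exists q0 => //.
  apply: subset_closure; have hullT : T `<=` convex_hull T by exact: sub_smallest.
  by apply: (hullT _ (extT _ (conj q0ext _))); rewrite q01 oppr_le0 ltW.
have kp : kappa <= pdot ip p p.
  have up : c / 2 <= pdot ip u p.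
    have [[q clq <-] _] := pmin; rewrite pdotDr -lerBlDr.
    apply: closure_convex_hull_ge clq => q' /Tdl/zsep.
    by rewrite pdotDr -lerBlDr.
  rewrite -sqr_pnorm /kappa ler_pXn2r ?nnegrE ?pnorm_ge0//; last first.
    by rewrite !divr_ge0 ?pnorm_ge0// ltW.
  by rewrite ler_pdivrMr// [leRHS]mulrC (le_trans up)// pdot_le.
have dl_le0 q : dl y q -> q.1 <= 0.
  by move=> dlq; apply: normalized_le0 (norml _ Uy) dlq.
have z01 : 0 <= z.1 <= eta by rewrite zeta (du_ge0 y)//; exact: zext.1.
have dec := model_decrease dly0 cdly duy0 cduy dl_le0 extT zext.1 z01 pmin kp
  pN qzN (erefl b) (ltW b0) bN anu.
have Dxr : closed_ball_ Num.norm 0 r (- (s *: p.2)).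
  rewrite /closed_ball_ /= sub0r opprK normrZ gtr0_norm//.
  rewrite -[leRHS](divfK (lt0r_neq0 N0)) ler_pM2l//.
  exact: le_trans (snd_le_pnorm p) pN.
have yE : y + a *: (- (s *: p.2)) = y - b *: p.2.
  by rewrite scalerN scalerA.
exists b; split => //; first exact: ltW.
  rewrite -yE; apply: (CrU y Cy); move: Dxr.
  rewrite /closed_ball_ /= sub0r opprD addNKr !normrN => Dxr.
  by rewrite normrZ gtr0_norm// (le_trans _ Dxr)// normrN ler_piMl.
have := aapprox y _ Cy Dxr; rewrite ltr_norml => /andP[_].
rewrite /codiff_error yE [a^-1 * _]mulrC ltr_pdivrMr//.
have : eta <= b * kappa / 8 by rewrite ge_min lexx.
move: dec; rewrite /b; lra.
Qed.

(** * The sequence generated by the method *)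

Lemma limn_einf_gt0 (v : nat -> \bar R) :
  (0 < limn_einf v)%E ->
  exists2 c, 0 < c & \forall n \near \oo, (c%:E <= v n)%E.
Proof.
rewrite limn_einf_lim (cvg_lim _ (@cvg_einfs_sup _ v))//.
move=> /ereal_sup_gt[_ [k _ <-] vk].
have [c c0 cv] : exists2 c : R, 0 < c & (c%:E <= einfs v k)%E.
  move: vk; case: (einfs v k) => [c|_|//]; last by exists 1; rewrite ?leey.
  by rewrite lte_fin => c0; exists c.
exists c => //; exists k => // n /= kn; apply: (le_trans cv).
by apply: ereal_inf_lbound; exists n.
Qed.

Lemma no_infinite_descent (g : nat -> R) D B :
  0 < D -> (forall n, B <= g n) -> (forall n, g n.+1 <= g n) ->
  ~ (forall n, exists2 k, (n <= k)%N & g k.+1 <= g k - D).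
Proof.
move=> D0 gB gle gD.
have {}gle m n : (m <= n)%N -> g n <= g m.
  by move/nonincreasing_seqP: gle; apply.
have drop k : exists n, g n <= g 0%N - k%:R * D.
  elim: k => [|k [n gn]]; first by exists 0%N; rewrite mul0r subr0.
  have [l nl gl] := gD n; exists l.+1; have := gle _ _ nl.
  by rewrite -natr1; lra.
have [n] := drop (Num.truncn ((g 0%N - B) / D)).+1.
have := truncnS_gt ((g 0%N - B) / D); rewrite ltr_pdivrMr//.
by have := gB n; lra.
Qed.

Section MCD.
Variables (U : set H) (f : H -> R) (dl du : H -> set RH).
Variables (dlT duT : \bar R -> H -> set RH).
Variables (nu mu : nat -> \bar R) (astar : \bar R) (x : nat -> H).
Hypothesis xMCD : MCD_sequence ip U f dlT duT nu mu astar x.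

Lemma MCD_in n : U (x n).
Proof.
have [U0 [p [alpha [zs step]]]] := xMCD.
case: n => // n; have [_ argmin_a [duz _] ->] := step n.
by have [[_ _]] := argmin_a _ duz.
Qed.

(** Both minimizations of an iteration are exact, so the next value can be
    compared with any admissible step along any of the search directions. *)
Lemma MCD_le n z : duT (mu n) (x n) z -> exists2 p,
  argmin [set q + z | q in closure (convex_hull (dlT (nu n) (x n)))]
    (pnorm ip) p &
  forall b, 0 <= b -> (b%:E <= astar)%E -> U (x n - b *: p.2) ->
    f (x n.+1) <= f (x n - b *: p.2).
Proof.
move=> duz; have [_ [p [alpha [zs step]]]] := xMCD.
have [argmin_p argmin_a [_ argmin_z] xE] := step n.
exists (p n z); first exact: argmin_p.
move=> b b0 ba Ub; rewrite xE; apply: le_trans (argmin_z _ duz) _.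
by apply: (argmin_a _ duz).2.
Qed.

Lemma MCD_nonincreasing n : (0 <= astar)%E -> f (x n.+1) <= f (x n).
Proof.
move=> astar0; have [_ [p [alpha [zs step]]]] := xMCD.
have [_ _ [duz _] _] := step n.
have [q _ /(_ 0)] := MCD_le duz; rewrite scale0r subr0; apply => //.
exact: MCD_in.
Qed.

End MCD.

(** If the conclusion failed, every visit of a neighbourhood of [xs] at a late
    iteration would lower [f] by a fixed amount. *)
Lemma MCD_stationary (U : set H) (f : H -> R) (dl du : H -> set RH)
    (dlT duT : \bar R -> H -> set RH) (nu mu : nat -> \bar R) (astar : \bar R)
    (x : nat -> H) (xs w : H) :
  codiff_on U f dl du -> truncation U dl du dlT duT ->
  (forall n, (0 <= nu n)%E) -> (forall n, (0 <= mu n)%E) -> (0 < astar)%E ->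
  MCD_sequence ip U f dlT duT nu mu astar x ->
  U xs -> cluster (x @ \oo) xs ->
  hausdorff_continuous_at ip dl xs -> hausdorff_continuous_at ip du xs ->
  (exists C : set H, [/\ nbhs xs C, C `<=` U &
     uniformly_approximates ip U f dl du C]) ->
  has_lbound (f @` U) -> (0 < limn_einf nu)%E -> (0 < limn_einf mu)%E ->
  du xs (0, w) -> dl xs (- (0, w)).
Proof.
move=> codiff trunc nu_ge0 mu_ge0 astar0 xMCD Uxs clx dlx dux approx [B fB].
move=> /limn_einf_gt0[nu0 nu00 nuE] /limn_einf_gt0[mu0 mu00 muE] duw.
apply: contrapT => ndlw.
have [a0 a00 a0astar] : exists2 a, 0 < a & (a%:E <= astar)%E.
  move: astar0; case: (astar) => [a|_|//]; last by exists 1; rewrite ?leey.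
  by rewrite lte_fin => ?; exists a.
have [D D0 near_xs] := descent_near codiff Uxs dlx dux approx duw ndlw
  nu00 mu00 a00.
apply: (@no_infinite_descent (f \o x) D B D0) => [n|n|n].
- by apply: fB; exists (x n) => //; exact: MCD_in xMCD n.
- by apply: MCD_nonincreasing xMCD n _; exact: ltW.
pose late := [set k | ((n <= k)%N /\ (nu0%:E <= nu k)%E) /\ (mu0%:E <= mu k)%E].
have [|y [[k [[nk nuk] muk] <-] [z [zext zmu zdec]]]] :=
    clx [set x k | k in late] _ _ near_xs.
  have nn : \forall k \near \oo, (n <= k)%N by exists n.
  by apply: filterS (filterI (filterI nn nuE) muE) => k h; exists k.
have Ux := MCD_in xMCD k.
have [_ _ duTz _] := trunc (mu k) (x k) (mu_ge0 k) Ux.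
have [dlText dlTsub _ _] := trunc (nu k) (x k) (nu_ge0 k) Ux.
have duz : duT (mu k) (x k) z.
  by apply: duTz; split => //; apply: le_trans muk; rewrite lee_fin.
have [p pmin pdec] := MCD_le xMCD duz.
have [|b [b0 ba Ub fb]] := zdec _ p dlTsub _ pmin.
  move=> q [qext qnu]; apply: dlText; split => //.
  by rewrite leeNl (le_trans _ nuk)// -EFinN lee_fin lerNl.
exists k => //=; apply: le_trans fb; apply: pdec => //.
by apply: le_trans a0astar; rewrite lee_fin.
Qed.

(** * Convex functions *)

(** If [f y < f xs], convexity gives [f (xs + a Dx) - f xs <= - a d] with [d > 0].
    Stationarity at [(0, w0)] bounds the maximum over [A] below by the negative
    of [a] times the slope of [w0], so [B] contains, for every small [a], a point
    at which [b + a <w, Dx>] is at most [a] times the slope of [w0] minus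
    [a d / 2]. A limit point for [a] tending to [0] has first component [0] and
    a slope smaller than the least one. *)
Lemma convex_stationary_min (U : set H) (f : H -> R) (A B : set RH) xs y :
  is_codifferential ip f xs A B -> normalized A B ->
  (forall w, B (0, w) -> A (- (0, w))) ->
  convex_function U f -> U xs -> U y -> f xs <= f y.
Proof.
move=> [[A0 _ cA] [B0 _ cB] codiff _] norml stat cvf Uxs Uy.
rewrite leNgt; apply/negP => fy.
pose Dx := y - xs; pose d := f xs - f y.
have d0 : 0 < d by rewrite subr_gt0.
have B_ge0 z : B z -> 0 <= z.1 by exact: normalized_ge0 norml.
have cvx a : 0 <= a <= 1 -> f (xs + a *: Dx) - f xs <= - (a * d).
  move=> /andP[a0 a1].
  have : f (a *: y + (1 - a) *: xs) <= a * f y + (1 - a) * f xs.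
    exact: cvf (Itv01 a0 a1) y xs (mem_set Uy) (mem_set Uxs).
  have -> : a *: y + (1 - a) *: xs = xs + a *: Dx.
    by rewrite /Dx scalerBr scalerBl scale1r addrCA.
  by rewrite /d; lra.
have fst p : pdot ip (1, 0) p = p.1.
  by rewrite /pdot /= mul1r (linear0l ip) addr0.
(* w0 minimizes the slope along Dx on the face of B on which b = 0 *)
have [[b w0] [Bw0 /= b_le0] w0min] : exists2 p, (B `&` [set p | p.1 <= 0]) p &
    forall q, (B `&` [set p | p.1 <= 0]) q -> ip p.2 Dx <= ip q.2 Dx.
  have [q Bq [qE qmin]] := set_min_affine 0 0 B0 cB.
  have q1 : q.1 = 0.
    move: qE; under eq_imagel do rewrite mul0r addr0.
    by rewrite norml.2 mul0r addr0.
  have cface : weakly_compact (B `&` [set p | p.1 <= 0]).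
    apply: compact_closedI => //.
    have := @weakly_closed_pdot_ge (- (1, 0)) 0.
    by under eq_set => p do rewrite pdotNl fst oppr_ge0.
  have [|p Bp pmax] := pdot_argmax (- (0, Dx)) _ cface.
    by exists q; split => //=; rewrite q1.
  exists p => // r /pmax; rewrite !pdotNl lerN2 /pdot /= !mul0r !add0r.
  by rewrite !(dotC Dx).
have b0 : b = 0 by apply/eqP; rewrite eq_le b_le0 (B_ge0 (b, w0)).
rewrite b0 {b b0 b_le0} in Bw0 w0min.
pose h (z : RH) := ip w0 Dx - d / 2 - ip z.2 Dx.
have model : \forall a \near 0^'+, exists2 z, B z & z.1 <= a * h z.
  have d20 : 0 < d / 2 by rewrite divr_gt0.
  have /cvgr0Pnorm_lt/(_ _ d20) err := codiff Dx.
  have le1 := nbhs_right_le (@ltr01 R).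
  apply: filterS3 err (nbhs_right_gt 0) le1 => a err a0 a1.
  have [q qext [qE qmax]] := set_max_affine a Dx A0 cA.
  have [z Bz [zE _]] := set_min_affine a Dx B0 cB.
  exists z => //; move: err; rewrite /codiff_error qE zE normr_id ltr_norml.
  move=> /andP[+ _]; rewrite [a^-1 * _]mulrC ltr_pdivlMr// => err.
  have := qmax _ (stat _ Bw0); rewrite /= oppr0 add0r (linearNl ip) /= => qw0.
  have a01 : 0 <= a <= 1 by rewrite ltW.
  by have := cvx a a01; rewrite /h; lra.
have [a0 a00 ha0] : exists2 a0, 0 < a0 & forall a, 0 < a <= a0 ->
    exists2 z, B z & z.1 <= a * h z.
  have [e /= e0 he] := model.
  exists (e / 2); first by rewrite divr_gt0.
  move=> a /andP[a0 ae]; apply: he => //=.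
  by rewrite sub0r normrN gtr0_norm//; lra.
(* The sets below decrease as a decreases to 0, so they have a common point. *)
pose Z a : set (weak_space RH) :=
  [set z | 0 <= z.1] `&` [set z | z.1 <= a * h z].
have [||z [Bz nz]] := @compact_open_chain (weak_space RH) B
    [set ~` Z a | a in [set a | 0 < a <= a0]] cB B0.
- have ZZ a a' : 0 < a -> a <= a' -> Z a `<=` Z a'.
    move=> a_gt0 aa' z [z0 za]; split => //=; apply: (le_trans za).
    rewrite ler_wpM2r// -(pmulr_rge0 _ a_gt0); exact: le_trans z0 za.
  move=> _ _ [a /andP[a_gt0 _] <-] [a' /andP[a'_gt0 _] <-].
  by have [aa'|/ltW a'a] := leP a a'; [right|left]; apply: subsetC; exact: ZZ.
- move=> _ [a a01 <-]; split.
    apply: closed_openC; apply: closedI.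
      have := @weakly_closed_pdot_ge (1, 0) 0.
      by under eq_set => p do rewrite fst.
    have := @weakly_closed_pdot_ge (- (1, a *: Dx)) (- (a * (ip w0 Dx - d / 2))).
    congr (closed _); apply/seteqP.
    by split => p /=; rewrite pdotNl lerN2 pdot_pair /h; lra.
  have [z Bz zh] := ha0 a a01; exists z; split => //; apply.
  by split=> //=; exact: B_ge0.
have Zz a : 0 < a <= a0 -> z.1 <= a * h z.
  move=> a01; have : Z a z.
    by apply: contrapT => nZ; apply: nz; exists (~` Z a) => //; exists a.
  by case.
have z0 := B_ge0 z Bz.
have hz : 0 <= h z.
  rewrite -(pmulr_rge0 _ a00); apply: le_trans z0 (Zz a0 _).
  by rewrite a00 lexx.
have z_le0 : z.1 <= 0.
  apply/ler_addgt0Pr => e e0; rewrite add0r.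
  pose a := Num.min a0 (e / (h z + 1)).
  have h1 : 0 < h z + 1 by lra.
  have a_gt0 : 0 < a by rewrite lt_min a00 divr_gt0.
  have ae : a * (h z + 1) <= e by rewrite -ler_pdivlMr// ge_min lexx orbT.
  by apply: le_trans (Zz a _) _; [rewrite a_gt0 ge_min lexx|lra].
by have := w0min z (conj Bz z_le0); rewrite /= /h in hz *; lra.
Qed.

End Codifferentials.

Theorem theorem3 (R : realType) (H : completeNormedModType R)
    (ip : {dot H for (@idfun R)}) (ip_norm : forall x : H, `|x| ^+ 2 = ip x x)
    (U : set H) (f : H -> R) (dl du : H -> set (R^o * H))
    (dlT duT : \bar R -> H -> set (R^o * H))
    (nu mu : nat -> \bar R) (astar : \bar R) (x : nat -> H) (xs : H)
    (openU : open U)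
    (codiff : forall y, U y -> is_codifferential ip f y (dl y) (du y))
    (norml : forall y, U y -> normalized (dl y) (du y))
    (trunc : truncation U dl du dlT duT)
    (nu_ge0 : forall n, (0 <= nu n)%E) (mu_ge0 : forall n, (0 <= mu n)%E)
    (astar_gt0 : (0 < astar)%E)
    (xMCD : MCD_sequence ip U f dlT duT nu mu astar x)
    (Uxs : U xs) (xs_cluster : cluster (x @ \oo) xs)
    (dl_cont : hausdorff_continuous_at ip dl xs)
    (du_cont : hausdorff_continuous_at ip du xs)
    (approx : exists C : set H, [/\ nbhs xs C, C `<=` U &
       uniformly_approximates ip U f dl du C])
    (f_bounded : has_lbound (f @` U))
    (nu_liminf : (0 < limn_einf nu)%E) (mu_liminf : (0 < limn_einf mu)%E)
    (alt : finite_dimensional H \/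
       exists2 muhat : R, 0 < muhat &
         \forall n \near \oo,
           [set p | du (x n) p /\ p.1 <= muhat] `<=` duT (mu n) (x n)) :
  inf_stationary (dl xs) (du xs) /\
  (convex_set U -> convex_function U f -> forall y, U y -> f xs <= f y).
Proof.
have codiffU : codiff_on ip U f dl du by [].
have stat w : du xs (0, w) -> dl xs (- (0, w)).
  exact: (MCD_stationary ip_norm codiffU trunc nu_ge0 mu_ge0 astar_gt0 xMCD
    Uxs xs_cluster dl_cont du_cont approx f_bounded nu_liminf mu_liminf).
split=> [w [duw _]|_ cvf y Uy].
  by exists (- (0, w)); [exact: stat|rewrite addNr].
exact: (convex_stationary_min ip_norm (codiff _ Uxs) (norml _ Uxs) stat cvf).
Qed.
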